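(* A bitopological space $(X,\tau_1,\tau_2)$ is pairwise almost Lindelöf if and only if its pairwise semiregularization $(X,\tau^s_{(1,2)},\tau^s_{(2,1)})$ is pairwise almost Lindelöf.
   Context: A bitopological space $(X,\tau_1,\tau_2)$ is a set $X$ with two topologies (no separation axioms assumed). For a topology $\sigma$ on $X$, $\sigma\text{-}\mathrm{int}$ and $\sigma\text{-}\mathrm{cl}$ denote interior and closure with respect to $\sigma$. For $i\ne j$ in $\{1,2\}$, a set $S\subseteq X$ is $(\tau_i,\tau_j)$-regular open if $\tau_i\text{-}\mathrm{int}(\tau_j\text{-}\mathrm{cl}(S))=S$. The topology on $X$ generated by the $(\tau_i,\tau_j)$-regular open sets (they are closed under finite intersections and form a base for it) is denoted $\tau^s_{(i,j)}$; the space $(X,\tau^s_{(1,2)},\tau^s_{(2,1)})$ is the pairwise semiregularization of $(X,\tau_1,\tau_2)$. For two topologies $\sigma,\sigma'$ on $X$, the space is $(\sigma,\sigma')$-almost Lindelöf if for every cover $\{U_\alpha:\alpha\in\Delta\}$ of $X$ by $\sigma$-open sets there is a countable subset $\{\alpha_n:n\in\mathbb{N}\}$ of $\Delta$ with $X=\bigcup_{n\in\mathbb{N}}\sigma'\text{-}\mathrm{cl}(U_{\alpha_n})$. A bitopological space $(X,\sigma_1,\sigma_2)$ is pairwise almost Lindelöf if it is both $(\sigma_1,\sigma_2)$-almost Lindelöf and $(\sigma_2,\sigma_1)$-almost Lindelöf. *)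

(* Defs.v *)
From HB Require Import structures.
From mathcomp Require Import all_boot all_classical all_analysis.

Set Implicit Arguments.
Unset Strict Implicit.
Unset Printing Implicit Defensive.

Local Open Scope classical_set_scope.

(* A bitopological space is a type X with two inhabitants of [Topological X],
   as in [sup_topology]; [topo s] is X seen as a space with the topology s. *)
Definition topo (X : Type) (s : Topological X) : topologicalType :=
  Topological.Pack s.

Definition open_in (X : Type) (s : Topological X) : set (set X) :=
  @open (topo s).

Definition interior_in (X : Type) (s : Topological X) (A : set X) : set X :=
  @interior (topo s) A.

Definition closure_in (X : Type) (s : Topological X) (A : set X) : set X :=
  @closure (topo s) A.

Definition pair_regopen (X : Type) (s t : Topological X) (S : set X) : Prop :=
  interior_in s (closure_in t S) = S.

(* Type alias for X, carrying the topology generated by the (s,t)-regular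
   open sets. *)
Definition semireg_type (X : Type) (s t : Topological X) : Type := X.

HB.instance Definition _ (X : Type) (s t : Topological X) :=
  Choice.copy (semireg_type s t) (topo s).

HB.instance Definition _ (X : Type) (s t : Topological X) :=
  isSubBaseTopological.Build (semireg_type s t) [set S | pair_regopen s t S] id.

Definition semireg (X : Type) (s t : Topological X) : Topological X :=
  Topological.class (semireg_type s t : topologicalType).

Definition almost_lindelof (X : Type) (s t : Topological X) : Prop :=
  forall (I : Type) (U : I -> set X),
    (forall i, open_in s (U i)) -> \bigcup_i U i = setT ->
    exists2 J : set I, countable J & \bigcup_(i in J) closure_in t (U i) = setT.

Definition pairwise_almost_lindelof (X : Type) (t1 t2 : Topological X) : Prop :=
  almost_lindelof t1 t2 /\ almost_lindelof t2 t1.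

(* Main.v *)
Require Import Defs.
From mathcomp Require Import all_boot finmap all_classical all_analysis.

(** Write [s^] and [t^] for the semiregularizations [semireg s t] and
    [semireg t s].  The equivalence holds for each ordered pair of topologies
    separately: [(X, s, t)] is almost Lindelof iff [(X, s^, t^)] is
    ([almost_lindelof_semireg]).

    Since [s^] is coarser than [s] and [t^] coarser than [t], passing from
    [(s, t)] to [(s^, t^)] allows fewer covers and makes closures larger, so
    the property is inherited ([semireg_coarser], [closure_sub_semireg]).

    In the other direction, enlarge each member [U] of an [s]-open cover to
    the [(s, t)]-regular open set [s-int (t-cl U)], which is [s^]-open.  This
    costs nothing in the conclusion, because [t-cl U] is already [t^]-closed
    when [U] is [s]-open ([closure_open_semireg]): its complement is the
    [t]-interior of the [s]-closed set [~` U], and such interiors are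
    [(t, s)]-regular open ([pair_regopen_interior]). *)

Set Implicit Arguments.
Unset Strict Implicit.
Unset Printing Implicit Defensive.

Local Open Scope classical_set_scope.

Section pairwise_semiregularization.
Context (X : Type).
Implicit Types (s t : Topological X) (A U : set X).

(** An [s]-closed [A] contains [s-cl (t-int A)], whose [t]-interior therefore
    cannot exceed [t-int A]; the other inclusion holds for every [t]-open
    set. *)
Lemma pair_regopen_interior s t A :
  open_in s (~` A) -> pair_regopen t s (interior_in t A).
Proof.
move=> oAC; apply/seteqP; split.
  have cA : @closed (topo s) A by rewrite -[A]setCK; exact: open_closedC.
  apply: (@interiorS (topo t)).
  rewrite [X in _ `<=` X](closure_id (T := topo s) A).1 //.
  by apply: (@closureS (topo s)); exact: (@interior_subset (topo t)).
rewrite /interior_in -(@open_subsetE (topo t)).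
  exact: (@subset_closure (topo s)).
exact: (@open_interior (topo t)).
Qed.

Lemma pair_regopen_interior_closure s t U :
  pair_regopen s t (interior_in s (closure_in t U)).
Proof.
apply: pair_regopen_interior.
by apply: (@closed_openC (topo t)); exact: (@closed_closure (topo t)).
Qed.

Lemma pair_regopen_open s t U : pair_regopen s t U -> open_in s U.
Proof. by move=> <-; exact: (@open_interior (topo s)). Qed.

Lemma pair_regopen_semireg s t U :
  pair_regopen s t U -> open_in (semireg s t) U.
Proof.
move=> rU; exists [set U]; last by rewrite bigcup_set1.
move=> _ ->; exists [fset U]%fset; first by move=> V /fset1P ->; rewrite inE.
by rewrite set_fset1 bigcap_set1.
Qed.

(** The generators of [semireg s t] are fixed points of an [s]-interior, hence
    [s]-open, and unions of finite intersections of them remain so. *)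
Lemma semireg_coarser s t U : open_in (semireg s t) U -> open_in s U.
Proof.
case=> D' sD' <-; apply: (@bigcup_open (topo s)) => V /sD'[F sF <-].
rewrite bigcap_fset big_seq; apply: (big_ind (@open (topo s))).
- exact: openT.
- exact: openI.
- by move=> W /sF; rewrite inE; exact: pair_regopen_open.
Qed.

Lemma closure_sub_semireg s t A :
  closure_in t A `<=` closure_in (semireg t s) A.
Proof.
rewrite /closure_in (@closureE (topo t)); apply: smallest_sub.
  rewrite -[X in closed X]setCK; apply: open_closedC.
  apply: (@semireg_coarser t s); apply: (@closed_openC (topo (semireg t s))).
  exact: closed_closure.
exact: (@subset_closure (topo (semireg t s))).
Qed.

(** This is where openness of [U] enters: for an arbitrary set the closure in
    [semireg t s] may be larger than the one in [t]. *)
Lemma closure_open_semireg s t U : open_in s U ->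
  @closed (topo (semireg t s)) (closure_in t U).
Proof.
move=> oU; rewrite -[X in closed X]setCK; apply: open_closedC.
rewrite /closure_in -(@interiorC (topo t)).
by apply: pair_regopen_semireg; apply: pair_regopen_interior; rewrite setCK.
Qed.

Lemma almost_lindelof_semireg s t :
  almost_lindelof s t <-> almost_lindelof (semireg s t) (semireg t s).
Proof.
split=> L I U oU cU.
  have [J cJ UJ] := L I U (fun i => semireg_coarser (oU i)) cU.
  exists J => //; rewrite -subTset -UJ.
  by apply: subset_bigcup => i _; exact: closure_sub_semireg.
(* The cover has to be enlarged because U i itself need not be open in
   semireg s t. *)
pose V i := interior_in s (closure_in t (U i)).
have UV i : U i `<=` V i.
  rewrite /V /interior_in -(@open_subsetE (topo s)); last exact: oU.
  exact: (@subset_closure (topo t)).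
have [|| J cJ VJ] := L I V.
- by move=> i; apply: pair_regopen_semireg; exact: pair_regopen_interior_closure.
- by rewrite -subTset -cU; apply: subset_bigcup => i _; exact: UV.
exists J => //; rewrite -subTset -VJ; apply: subset_bigcup => i _.
rewrite {1}/closure_in (@closureE (topo (semireg t s))).
apply: smallest_sub; first exact: closure_open_semireg.
exact: (@interior_subset (topo s)).
Qed.

End pairwise_semiregularization.

Theorem corollary4p5 (X : Type) (t1 t2 : Topological X) :
  pairwise_almost_lindelof t1 t2 <->
  pairwise_almost_lindelof (semireg t1 t2) (semireg t2 t1).
Proof.
split=> -[L12 L21]; split.
- exact: (almost_lindelof_semireg t1 t2).1.
- exact: (almost_lindelof_semireg t2 t1).1.
- exact: (almost_lindelof_semireg t1 t2).2.
- exact: (almost_lindelof_semireg t2 t1).2.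
Qed.
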